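(* Let $\mathcal H$ be a complex separable Hilbert space, $K\subset H$ an inclusion of standard subspaces of $\mathcal H$, and $D_H$ the polarizer of $H$. (a) One has the real orthogonal direct sum decomposition $$H=(K'\cap H)\oplus_{\mathbb R}\overline{D_HK},\qquad K'\cap H=\ker(E_KD_H).$$ (b) Let $Q_H$ be the spectral projection of $\Delta_H$ for the eigenvalue $1$ and $\tilde H:=(1-Q_H)H$, so that $H=(H\cap H')\oplus\tilde H$. Then $$K'\cap H=(H'\cap H)\oplus D_{\tilde H}^{-1}\left(K^{\perp_{\mathbb R}}\cap\tilde H\cap\operatorname{dom}D_{\tilde H}^{-1}\right).$$ (c) If $K'\cap H$ is cyclic, then $(K'\cap H)'\cap\overline{D_HK}=\{0\}$. (d) $K\cap D_HK\cap\operatorname{dom}\Delta_H\subset K\cap(iK+iH')\subset K\cap D_HK$.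
   Context: Inner products are linear in the second argument. A closed real linear subspace $X\subset\mathcal H$ is cyclic if $X+iX$ is dense, separating if $X\cap iX=\{0\}$, standard if both. $X'=\{v:\operatorname{Im}\langle v,x\rangle=0\ \forall x\in X\}$ is the symplectic complement and $X^{\perp_{\mathbb R}}=iX'$ the orthogonal complement with respect to $\operatorname{Re}\langle\cdot,\cdot\rangle$. For $H$ standard, $S_H:H+iH\to H+iH$, $h_1+ih_2\mapsto h_1-ih_2$, has polar decomposition $S_H=J_H\Delta_H^{1/2}$, which defines the modular operator $\Delta_H$. $E_X$ is the real orthogonal projection of $\mathcal H$ (as real Hilbert space with $\operatorname{Re}\langle\cdot,\cdot\rangle$) onto a closed real subspace $X$. The polarizer of $H$ is the unique bounded real linear operator $D_H:H\to H$ with $\operatorname{Im}\langle h,k\rangle=\operatorname{Re}\langle h,D_Hk\rangle$ for all $h,k\in H$; explicitly $D_H=-E_Hi|_H=i(\Delta_H-1)(\Delta_H+1)^{-1}|_H$. Its kernel is $H\cap H'$. In (b): the range of $Q_H$ is $(H\cap H')+i(H\cap H')$; $\tilde H$ is a standard subspace of $(1-Q_H)\mathcal H$ with $\tilde H\cap\tilde H'=\{0\}$, so its polarizer $D_{\tilde H}:\tilde H\to\tilde H$ is injective, and $D_{\tilde H}^{-1}$ is its (possibly unbounded) inverse with domain $\operatorname{dom}D_{\tilde H}^{-1}=D_{\tilde H}\tilde H$. *)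

(* Defs.v *)
From HB Require Import structures.
From mathcomp Require Import all_boot all_order all_algebra.
From mathcomp Require Import complex.
From mathcomp Require Import all_classical all_reals all_analysis.

Set Implicit Arguments.
Unset Strict Implicit.
Unset Printing Implicit Defensive.

Import Order.TTheory GRing.Theory Num.Theory.
Import numFieldNormedType.Exports.

Local Open Scope classical_set_scope.
Local Open Scope ring_scope.
Local Open Scope complex_scope.

(* A complex Hilbert space is a complete normed space V over R[i] whose norm
   comes from an inner product ip, linear in its second argument. *)
Record inner_product (R : realType) (V : completeNormedModType R[i])
    (ip : V -> V -> R[i]) : Prop := InnerProduct {
  ip_linearr : forall (x y z : V) (a : R[i]),
    ip x (a *: y + z) = a * ip x y + ip x z ;
  ip_conj : forall x y : V, ip y x = (ip x y)^* ;
  ip_norm : forall x : V, ip x x = `|x| ^+ 2 }.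

Definition separable (T : topologicalType) : Prop :=
  exists2 A : set T, countable A & dense A.

Section Subspaces.
Context (R : realType) (V : completeNormedModType R[i]) (ip : V -> V -> R[i]).
Implicit Types X Y : set V.

Definition closed_real_subspace X : Prop :=
  [/\ X 0, (forall (a : R) (x y : V), X x -> X y -> X (a%:C *: x + y))
    & closed X].

Definition imul X : set V := [set 'i *: x | x in X].

Definition sumset X Y : set V := [set v | exists x y, [/\ X x, Y y & v = x + y]].

Definition cyclic_subspace X : Prop := dense (sumset X (imul X)).

Definition separating_subspace X : Prop := X `&` imul X = [set 0].

Definition standard X : Prop :=
  [/\ closed_real_subspace X, cyclic_subspace X & separating_subspace X].

Definition symplectic_compl X : set V :=
  [set v | forall x, X x -> complex.Im (ip v x) = 0].

Definition real_orth_compl X : set V :=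
  [set v | forall x, X x -> complex.Re (ip v x) = 0].

Definition orth_compl X : set V := [set v | forall x, X x -> ip v x = 0].

(* Z is the orthogonal direct sum of X and Y, with respect to the real inner
   product Re ip, resp. to ip; orthogonality makes the sum direct. *)
Definition real_orth_sum Z X Y : Prop :=
  Y `<=` real_orth_compl X /\ Z = sumset X Y.

Definition orth_sum Z X Y : Prop := Y `<=` orth_compl X /\ Z = sumset X Y.

(* The orthogonal projections of v onto a closed real, resp. complex, subspace
   X: the unique p in X such that v - p is orthogonal to X. *)
Definition real_proj X (v : V) : V :=
  xget 0 [set p | X p /\ real_orth_compl X (v - p)].

Definition orth_proj X (v : V) : V :=
  xget 0 [set p | X p /\ orth_compl X (v - p)].

(* Only the restriction of D to X matters, and the last clause determines it. *)
Definition is_polarizer X (D : V -> V) : Prop :=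
  [/\ (forall k, X k -> X (D k)),
      (forall (a : R) (h k : V), X h -> X k ->
         D (a%:C *: h + k) = a%:C *: D h + D k),
      (exists M : R[i], forall k, X k -> `|D k| <= M * `|k|)
    & (forall h k, X h -> X k ->
         complex.Im (ip h k) = complex.Re (ip h (D k)))].

Definition polarizer X : V -> V := xget (fun=> 0) (is_polarizer X).

End Subspaces.

(* Possibly unbounded operators are given by their graphs. *)
Section Operators.
Context (R : realType) (V : completeNormedModType R[i]) (ip : V -> V -> R[i]).
Implicit Types (A B S T Delta : set (V * V)) (X : set V) (J : V -> V).

Definition op_dom A : set V := [set x | exists y, A (x, y)].

Definition op_image A X : set V := [set y | exists2 x, X x & A (x, y)].

Definition op_ker A : set V := [set x | A (x, 0)].

Definition op_comp A B : set (V * V) :=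
  [set p | exists2 y, B (p.1, y) & A (y, p.2)].

Definition op_adjoint A : set (V * V) :=
  [set p | forall x y, A (x, y) -> ip p.1 y = ip p.2 x].

(* For a densely defined A, the equality A = op_adjoint A forces A to be the
   graph of a (single-valued, linear, closed) operator. *)
Definition self_adjoint A : Prop := dense (op_dom A) /\ A = op_adjoint A.

Definition positive_op A : Prop := forall x y, A (x, y) -> 0 <= ip x y.

Definition antilinear J : Prop :=
  forall (a : R[i]) (x y : V), J (a *: x + y) = a^* *: J x + J y.

(* The polar decomposition S = J T of a closed densely defined antilinear
   operator S: T is positive and self-adjoint, and J is an antilinear partial
   isometry with the same kernel as S. *)
Definition polar_decomposition S J T : Prop :=
  [/\ self_adjoint T /\ positive_op T,
      antilinear J,
      (forall x, orth_compl ip [set y | J y = 0] x -> `|J x| = `|x|),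
      [set x | J x = 0] = op_ker S
    & S = [set p | exists2 y, T (p.1, y) & p.2 = J y]].

Definition tomita X : set (V * V) :=
  [set p | exists h1 h2, [/\ X h1, X h2, p.1 = h1 + 'i *: h2
                           & p.2 = h1 - 'i *: h2]].

(* Delta is the square of the positive self-adjoint factor Delta^(1/2) in the
   polar decomposition of the Tomita operator of X. *)
Definition modular_operator X Delta : Prop :=
  exists J T, polar_decomposition (tomita X) J T /\ Delta = op_comp T T.

Definition eigenspace_op A (l : R[i]) : set V := [set x | A (x, l *: x)].

(* The spectral projection of a self-adjoint operator A for an eigenvalue l. *)
Definition eigen_proj A (l : R[i]) : V -> V :=
  orth_proj ip (eigenspace_op A l).

Definition polarizer_inv X : set (V * V) :=
  [set p | X p.2 /\ p.1 = polarizer ip X p.2].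

End Operators.

(* Main.v *)
Require Import Defs.
From HB Require Import structures.
From mathcomp Require Import all_boot all_order all_algebra.
From mathcomp Require Import complex ring lra.
From mathcomp Require Import all_classical all_reals all_analysis.
Import numFieldNormedType.Exports.
Import Order.TTheory GRing.Theory Num.Theory.

Local Open Scope classical_set_scope.
Local Open Scope ring_scope.
Local Open Scope complex_scope.

(** Write (x, y) for the real inner product Re <x, y>. Since
    Im <h, k> = (h, - i k), the polarizer is D = - E_H i restricted to H, so
    the projection theorem for closed real subspaces (real_projection) gives
    its existence, and D is characterised by Im <h, k> = (h, D k) on H.

    (a) For h in H and k in K, Im <h, k> = (h, D k) = - (k, D h). So h lies in
    K' iff h is orthogonal to D K (symplectic_orth_image), which makes K' `&` H
    the orthogonal complement of D K in H; and h lies in K' iff D h is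
    orthogonal to K (symplectic_polarizer), that is, E_K D h = 0.

    (b) Let N = H `&` H'. The fixed space of Delta is N + i N
    (eigenspace_modular). If Delta x = x, positivity of T = Delta^(1/2) forces
    T x = x, so S x = J x; comparing <S x, k> = <J x, J T k> with <x, k> for k
    in H shows that both real components of x are in H'. Conversely, for h in N
    and J t = h, the vector t satisfies <t, T y> = <h, y> for all y in dom T,
    so T t = h because T is self-adjoint. A vector of H that is
    real orthogonal to N is orthogonal to it for the complex inner product
    too, because N is in H'; hence the spectral projection acts on H as
    the real projection onto N, and (1 - Q) H is the real orthogonal complement
    of N in H. The polarizer of that complement is the restriction of D
    (polarizer_center_compl), so the condition that D y is orthogonal to K,
    for y in the complement, describes K' there as in (a).

    (c) By (a) a vector in both sets is orthogonal, for the real and for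
    the imaginary part of the inner product, to a set whose complex span is
    dense.

    (d) D k = d iff d + i k is real orthogonal to H, and the real orthogonal
    complement of H is i H'. So membership of d in D K and in i K + i H'
    express the same relation between d and k, up to the sign of k
    (polarizer_eqP). *)

(** * The real inner product *)

Section RealInnerProduct.
Set Implicit Arguments.
Unset Strict Implicit.
Context (R : realType) (V : completeNormedModType R[i]) (ip : V -> V -> R[i]).
Hypothesis hip : inner_product ip.
Implicit Types (x y z v : V) (a t e : R) (X Y : set V).

Local Notation rdot x y := (complex.Re (ip x y)).
Local Notation sqn x := (rdot x x).

Lemma ipDr x y z : ip x (y + z) = ip x y + ip x z.
Proof. by rewrite -[y]scale1r (ip_linearr hip) scale1r mul1r. Qed.

Lemma ip0r x : ip x 0 = 0.
Proof. by apply: (addrI (ip x 0)); rewrite -ipDr !addr0. Qed.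

Lemma ipZr x y (c : R[i]) : ip x (c *: y) = c * ip x y.
Proof. by rewrite -[c *: y]addr0 (ip_linearr hip) ip0r addr0. Qed.

Lemma ipNr x y : ip x (- y) = - ip x y.
Proof. by rewrite -scaleN1r ipZr mulN1r. Qed.

Lemma ipDl x y z : ip (x + y) z = ip x z + ip y z.
Proof. by rewrite !(ip_conj hip z) ipDr rmorphD. Qed.

Lemma ipZl x y (c : R[i]) : ip (c *: x) y = conjc c * ip x y.
Proof. by rewrite !(ip_conj hip y) ipZr rmorphM. Qed.

Lemma ipNl x y : ip (- x) y = - ip x y.
Proof. by rewrite !(ip_conj hip y) ipNr rmorphN. Qed.

Lemma rdotC x y : rdot x y = rdot y x.
Proof. by rewrite (ip_conj hip x y); case: (ip x y). Qed.

Lemma ImC x y : complex.Im (ip x y) = - complex.Im (ip y x).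
Proof. by rewrite (ip_conj hip y x); case: (ip y x). Qed.

Lemma rdotDr x y z : rdot x (y + z) = rdot x y + rdot x z.
Proof. by rewrite ipDr; case: (ip x y); case: (ip x z). Qed.

Lemma rdotZr x y a : rdot x (a%:C *: y) = a * rdot x y.
Proof. by rewrite ipZr; case: (ip x y) => b c /=; rewrite mul0r subr0. Qed.

Lemma rdotNr x y : rdot x (- y) = - rdot x y.
Proof.
have -> : - y = (-1)%:C *: y by rewrite rmorphN1 scaleN1r.
by rewrite rdotZr mulN1r.
Qed.

Lemma rdotDl x y z : rdot (x + y) z = rdot x z + rdot y z.
Proof. by rewrite !(rdotC _ z) rdotDr. Qed.

Lemma rdotZl x y a : rdot (a%:C *: x) y = a * rdot x y.
Proof. by rewrite !(rdotC _ y) rdotZr. Qed.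

Lemma rdotNl x y : rdot (- x) y = - rdot x y.
Proof. by rewrite !(rdotC _ y) rdotNr. Qed.

Lemma rdot0r x : rdot x 0 = 0.
Proof. by rewrite ip0r. Qed.

Lemma rdot0l x : rdot 0 x = 0.
Proof. by rewrite rdotC rdot0r. Qed.

Lemma rdot_ir x y : rdot x ('i *: y) = - complex.Im (ip x y).
Proof.
rewrite ipZr -[Num.imaginary]/(Complex 0 1).
by case: (ip x y) => b c /=; rewrite mul0r mul1r sub0r.
Qed.

Lemma Im_ir x y : complex.Im (ip x ('i *: y)) = rdot x y.
Proof.
rewrite ipZr -[Num.imaginary]/(Complex 0 1).
by case: (ip x y) => b c /=; rewrite mul0r mul1r add0r.
Qed.

Lemma rdot_il x y : rdot ('i *: x) y = complex.Im (ip x y).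
Proof. by rewrite rdotC rdot_ir -ImC. Qed.

Lemma Im_il x y : complex.Im (ip ('i *: x) y) = - rdot x y.
Proof. by rewrite ImC Im_ir rdotC. Qed.

Lemma mulii x : 'i *: ('i *: x) = - x.
Proof. by rewrite scalerA -expr2 sqrCi scaleN1r. Qed.

Definition rdotE := (rdotDl, rdotDr, rdotZl, rdotZr, rdotNl, rdotNr).

Lemma ip_eq0 x y : rdot x y = 0 -> complex.Im (ip x y) = 0 -> ip x y = 0.
Proof. by case: (ip x y) => a b /= -> ->. Qed.

Lemma sqn_norm x : (sqn x)%:C = `|x| ^+ 2.
Proof.
by rewrite -(ip_norm hip) RRe_real// (ip_norm hip) rpredX// normr_real.
Qed.

Lemma sqn_ge0 x : 0 <= sqn x.
Proof. by rewrite -ler0c sqn_norm exprn_ge0. Qed.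

Lemma sqn_eq0 x : sqn x = 0 -> x = 0.
Proof.
move=> x0; apply/eqP; rewrite -normr_eq0 -sqrf_eq0 -sqn_norm.
by rewrite x0 rmorph0.
Qed.

Lemma sqnN x : sqn (- x) = sqn x.
Proof. by rewrite !rdotE opprK. Qed.

Lemma sqnBC x y : sqn (x - y) = sqn (y - x).
Proof. by rewrite -sqnN opprB. Qed.

Lemma sqnB x y : sqn (x - y) = sqn x - 2 * rdot x y + sqn y.
Proof. rewrite !rdotE (rdotC y x); ring. Qed.

Lemma norm_le_sqn x y : sqn x <= sqn y -> `|x| <= `|y|.
Proof. by rewrite -lecR !sqn_norm ler_pXn2r// nnegrE normr_ge0. Qed.

Lemma sqn_i x : sqn ('i *: x) = sqn x.
Proof. by rewrite rdot_il Im_ir. Qed.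

Lemma two_rdot_le x y : 2 * rdot x y <= sqn x + sqn y.
Proof. have := sqn_ge0 (x - y); rewrite sqnB; lra. Qed.

Lemma sqnZ a x : sqn (a%:C *: x) = a ^+ 2 * sqn x.
Proof. by rewrite rdotZl rdotZr mulrA expr2. Qed.

Lemma sqnD_le x y : sqn (x + y) <= 2 * (sqn x + sqn y).
Proof.
have := two_rdot_le x y; rewrite rdotDl !(rdotDr _ x) (rdotC y x); lra.
Qed.

Lemma ball_sqn x y e : 0 < e -> ball x e%:C y <-> sqn (x - y) < e ^+ 2.
Proof.
move=> e0; rewrite -ball_normE /= -ltcR sqn_norm rmorphXn /=.
by rewrite ltr_pXn2r// nnegrE ?normr_ge0// ler0c ltW.
Qed.

Lemma closure_sqn X x :
  closure X x <-> forall e, 0 < e -> exists2 y, X y & sqn (x - y) < e.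
Proof.
split=> [Xx e e0|Xx B /nbhs_ballP[r /=]].
  have se0 : 0 < Num.sqrt e by rewrite sqrtr_gt0.
  have /(nbhsx_ballx x)/Xx[y [Xy]] : 0 < (Num.sqrt e)%:C by rewrite ltcR.
  by move=> /(ball_sqn _ _ se0); rewrite sqr_sqrtr ?ltW//; exists y.
move=> r0 xrB; have /complex_realP[s rs] := gtr0_real r0.
move: r0 xrB; rewrite {}rs ltcR => s0 xB.
have [y Xy xy] := Xx _ (exprn_gt0 2 s0).
by exists y; split=> //; apply/xB/ball_sqn.
Qed.

Lemma dense_sqn X x e : dense X -> 0 < e -> exists2 y, X y & sqn (x - y) < e.
Proof.
move=> dX; move: e; apply/closure_sqn => B.
rewrite nbhsE => -[U [oU Ux] UB].
by have [|y [Uy Xy]] := dX U _ oU; [exists x|exists y; split=> //; apply: UB].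
Qed.

(** By Cauchy-Schwarz, the set of the y orthogonal to x is closed; stating this
    with the squared distance spares any continuity argument for the inner
    product. *)
Lemma rdot_eq0_approx v x :
  (forall e, 0 < e -> exists2 y, rdot y x = 0 & sqn (v - y) < e) ->
  rdot v x = 0.
Proof.
move=> vX.
(* If q = (v, x) is nonzero, take y close to v and compare
   2 t q = 2 t (v - y, x) <= |v - y|^2 + t^2 |x|^2 at t = q / (|x|^2 + 1). *)
pose N := sqn x + 1.
have N0 : 0 < N by have := sqn_ge0 x; rewrite /N; lra.
apply/eqP; apply: contraT => /eqP q0.
set q := rdot v x in q0 *.
have q2 : 0 < q ^+ 2 / N by rewrite divr_gt0// exprn_even_gt0//=; apply/eqP.
have [y yx vy] := vX _ q2.
have := two_rdot_le (v - y) ((q / N)%:C *: x).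
rewrite rdotZr rdotDl rdotNl yx subr0 -/q rdotZl rdotZr => le1.
have e1 : q / N * (q / N * sqn x) = q ^+ 2 / N - q ^+2 / N / N.
  rewrite /N; field. rewrite -/N; lra.
have : 0 < q ^+ 2 / N / N by rewrite divr_gt0.
have e2 : 2 * (q / N * q) = 2 * (q ^+ 2 / N) by ring.
move: le1; rewrite e1 e2; lra.
Qed.

(** * Closed real subspaces *)

Lemma closed_sqn X :
  closed X <-> forall x,
    (forall e, 0 < e -> exists2 y, X y & sqn (x - y) < e) -> X x.
Proof.
by split=> [cX x /closure_sqn/cX|cX x /closure_sqn/cX].
Qed.

Section ClosedRealSubspace.
Variable X : set V.
Hypothesis hX : closed_real_subspace X.

Lemma subspace0 : X 0.
Proof. by case: hX. Qed.

Lemma subspaceD x y : X x -> X y -> X (x + y).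
Proof.
by case: hX => _ lX _ Xx Xy; rewrite -[x]scale1r -[1](rmorph1 (real_complex R)); apply: lX.
Qed.

Lemma subspaceZ a x : X x -> X (a%:C *: x).
Proof. by case: hX => X0 lX _ Xx; rewrite -[_ *: x]addr0; apply: lX. Qed.

Lemma subspaceN x : X x -> X (- x).
Proof. by move=> Xx; rewrite -scaleN1r -(rmorphN1 (real_complex R)); exact: subspaceZ. Qed.

Lemma subspaceB x y : X x -> X y -> X (x - y).
Proof. by move=> Xx Xy; apply: subspaceD => //; apply: subspaceN. Qed.

Lemma subspace_closed : closed X.
Proof. by case: hX. Qed.

End ClosedRealSubspace.

Lemma closed_real_subspaceI X Y : closed_real_subspace X ->
  closed_real_subspace Y -> closed_real_subspace (X `&` Y).
Proof.
move=> [X0 lX cX] [Y0 lY cY]; split=> //; last exact: closedI.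
by move=> a x y [Xx Yx] [Xy Yy]; split; [apply: lX|apply: lY].
Qed.

Lemma closed_real_subspace_orth X : closed_real_subspace (real_orth_compl ip X).
Proof.
split=> [x _|a v w Xv Xw x Xx|]; first by rewrite rdotC rdot0r.
  by rewrite !rdotE Xv// Xw// mulr0 addr0.
apply/closed_sqn => v vX x Xx; apply: rdot_eq0_approx => e e0.
by have [y Xy vy] := vX e e0; exists y => //; apply: Xy.
Qed.

Lemma symplectic_compl_orth X :
  symplectic_compl ip X = real_orth_compl ip (imul X).
Proof.
apply/seteqP; split=> [v vX _ [x Xx <-]|v vX x Xx].
  by rewrite rdot_ir vX// oppr0.
by apply: oppr_inj; rewrite -rdot_ir oppr0; apply: vX; exists x.
Qed.

Lemma closed_real_subspace_symplectic X :
  closed_real_subspace (symplectic_compl ip X).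
Proof. by rewrite symplectic_compl_orth; exact: closed_real_subspace_orth. Qed.

Lemma closed_real_subspace_closure X : X 0 ->
  (forall a x y, X x -> X y -> X (a%:C *: x + y)) ->
  closed_real_subspace (closure X).
Proof.
move=> X0 lX; split; [exact: subset_closure| |exact: closed_closure].
move=> a x y /closure_sqn Xx /closure_sqn Xy; apply/closure_sqn => e e0.
(* |a u + w|^2 <= 2 (a^2 |u|^2 + |w|^2) *)
pose d := e / (2 * (a ^+ 2 + 1)).
have N0 : 0 < a ^+ 2 + 1 by have := sqr_ge0 a; lra.
have d0 : 0 < d by rewrite divr_gt0// mulr_gt0.
have [u Xu xu] := Xx d d0; have [w Xw yw] := Xy d d0.
exists (a%:C *: u + w); first exact: lX.
have -> : a%:C *: x + y - (a%:C *: u + w) = a%:C *: (x - u) + (y - w).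
  by rewrite scalerBr opprD addrACA.
apply: le_lt_trans (sqnD_le _ _) _; rewrite sqnZ.
have a0 := sqr_ge0 a.
have ed : e = 2 * (a ^+ 2 * d + d) by rewrite /d; field; rewrite gt_eqF.
have : a ^+ 2 * sqn (x - u) <= a ^+ 2 * d by rewrite ler_wpM2l// ltW.
rewrite ed; lra.
Qed.

(** * The projection theorem *)

(** By the parallelogram law the near-minimizers of the distance from v to X
    form a Cauchy filter base, and p is its limit. Every property of p needed
    later follows from near-minimizers x that are close to p. *)
Lemma minimizing_limit X v : X 0 ->
  (forall a x y, X x -> X y -> X (a%:C *: x + y)) ->
  exists2 d, (forall x, X x -> d <= sqn (v - x)) &
  exists p, forall e, 0 < e ->
    exists2 x, X x & sqn (v - x) < d + e /\ sqn (p - x) < e.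
Proof.
move=> X0 lX; pose E := [set sqn (v - x) | x in X].
have E0 : E !=set0 by exists (sqn (v - 0)), 0.
have lE : has_lbound E by exists 0 => _ [x _ <-]; apply: sqn_ge0.
have dX x : X x -> inf E <= sqn (v - x) by move=> Xx; apply: ge_inf => //; exists x.
exists (inf E) => //.
pose A e := X `&` [set x | sqn (v - x) < inf E + e].
have A0 e : 0 < e -> A e !=set0.
  move=> e0; have [|_ [x Xx <-] xe] := @inf_adherent _ E _ e0; first by split.
  by exists x.
(* the midpoint of x and y is in X, hence at squared distance at least inf E *)
have Adiam e x y : A e x -> A e y -> sqn (x - y) < 4 * e.
  move=> [Xx /= vx] [Xy /= vy].
  have Xm : X ((2^-1)%:C *: x + ((2^-1)%:C *: y + 0)) by do 2!apply: (lX) => //.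
  have := dX _ Xm.
  have -> : sqn (v - ((2^-1)%:C *: x + ((2^-1)%:C *: y + 0))) =
    (sqn (v - x)) / 2 + sqn (v - y) / 2 - sqn (x - y) / 4.
    rewrite !sqnB !rdotE !(rdot0l, rdot0r) (rdotC y x); by field.
  lra.
pose F : set_system V := filter_from [set e : R | 0 < e] A.
have FF : ProperFilter F.
  apply: filter_from_proper; last by move=> e /A0.
  apply: filter_from_filter.
    by exists 1; exact: ltr01.
  move=> e f /= e0 f0; exists (Num.min e f); first by rewrite /= lt_min e0.
  by move=> x [Xx /= h]; split; split=> //=;
    apply: (lt_le_trans h); rewrite lerD2l ge_min lexx ?orbT.
have : cauchy_ex F.
  move=> eps eps0; have /complex_realP[r er] := gtr0_real eps0.
  move: eps0; rewrite {}er ltcR => r0.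
  have r20 : 0 < r ^+ 2 / 4 by rewrite divr_gt0// exprn_gt0.
  have [x Ax] := A0 _ r20; exists x, (r ^+ 2 / 4) => // y Ay.
  by apply/ball_sqn => //; have := Adiam _ _ _ Ax Ay; lra.
move=> /cauchyP/cauchy_cvgP/cvg_ex[p Fp]; exists p => e e0.
have e1 : 0 < Num.sqrt e by rewrite sqrtr_gt0.
have pB : F (ball p (Num.sqrt e)%:C) by apply/Fp/nbhsx_ballx; rewrite ltcR.
have AeF : F (A e) by exists e.
have [x [[Xx vx] /(ball_sqn _ _ e1)]] := filter_ex (filterI AeF pB).
by rewrite sqr_sqrtr ?ltW// => px; exists x.
Qed.

(** The limit p of the near-minimizers is in X, and minimality passes to p in
    the form of the first-order condition. *)
Theorem real_projection X v : closed_real_subspace X ->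
  exists2 p, X p & real_orth_compl ip X (v - p).
Proof.
move=> hX; have [X0 lX cX] := hX.
have [d dX [p pX]] := minimizing_limit v X0 lX; exists p.
  by apply/(closed_sqn X).1 => // e e0; have [x Xx []] := pX e e0; exists x.
move=> y Xy; set q := rdot (v - p) y.
have N0 := sqn_ge0 y; set N := sqn y in N0.
(* perturbing a near-minimizer x by t y gives t q <= t^2 |y|^2 for every t *)
have qt t : t * q <= t ^+ 2 * N.
  apply/ler_addgt0Pr => e e0; have [x Xx [vx px]] := pX e e0.
  have := dX _ (lX t y x Xy Xx).
    have -> : v - (t%:C *: y + x) = (v - x) - t%:C *: y by rewrite opprD addrA addrAC.
  have := two_rdot_le (x - p) (t%:C *: y).
  rewrite (sqnBC x p) [sqn (_ - _ *: y)]sqnB !(sqnZ, rdotZr).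
  have -> : rdot (v - x) y = q + rdot (p - x) y by rewrite /q !rdotE; ring.
  rewrite -(opprB p x) rdotNl => h1 h2.
  have {}h2 : 2 * (t * q) <= 2 * (e + t ^+ 2 * N).
    move: h1 h2; rewrite -/N mulrN; move: (rdot (p - x) y) => r.
    rewrite mulrDr; lra.
  lra.
(* at t = q / (N + 1) the inequality t q <= t^2 N reads t^2 (N + 1) <= t^2 N *)
have := qt (q / (N + 1)).
have -> : q / (N + 1) * q = (q / (N + 1)) ^+ 2 * N + (q / (N + 1)) ^+ 2.
  by field; lra.
rewrite gerDl => q0; have : (q / (N + 1)) ^+ 2 = 0.
  by apply/eqP; rewrite eq_le q0 sqr_ge0.
move=> /eqP; rewrite sqrf_eq0 mulf_eq0 invr_eq0 => /orP[/eqP//|]; lra.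
Qed.

Lemma real_orth_self_eq0 X w : X w -> real_orth_compl ip X w -> w = 0.
Proof. by move=> Xw /(_ w Xw)/sqn_eq0. Qed.

Lemma real_proj_unique X v p : closed_real_subspace X -> X p ->
  real_orth_compl ip X (v - p) -> real_proj ip X v = p.
Proof.
move=> hX Xp vp; apply: xget_unique => // q [Xq vq].
apply/eqP; rewrite -subr_eq0; apply/eqP; apply: (@real_orth_self_eq0 X).
  exact: subspaceB.
move=> x Xx; have -> : q - p = (v - p) - (v - q) by rewrite opprB [RHS]addrC subrKA.
by rewrite rdotDl rdotNl vp// vq// subrr.
Qed.

Lemma real_projP X v : closed_real_subspace X ->
  X (real_proj ip X v) /\ real_orth_compl ip X (v - real_proj ip X v).
Proof.
move=> hX; have [p Xp vp] := real_projection v hX.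
by rewrite (real_proj_unique hX Xp vp).
Qed.

Lemma real_proj_contraction X v : closed_real_subspace X ->
  sqn (real_proj ip X v) <= sqn v.
Proof.
move=> /(real_projP v)[]; set p := real_proj _ _ _ => Xp /(_ p Xp).
have := sqn_ge0 (v - p); rewrite sqnB rdotDl rdotNl; lra.
Qed.

Lemma real_proj_eq0 X v : closed_real_subspace X ->
  real_proj ip X v = 0 <-> real_orth_compl ip X v.
Proof.
move=> hX; split=> [v0|vX]; last first.
  by apply: real_proj_unique; rewrite ?subr0//; exact: subspace0.
by have [_] := real_projP v hX; rewrite v0 subr0.
Qed.

Lemma orth_closure A : real_orth_compl ip (closure A) = real_orth_compl ip A.
Proof.
apply/seteqP; split=> v vA x Ax; first exact/vA/subset_closure.
rewrite rdotC; apply: rdot_eq0_approx => e e0.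
by have [y Ay xy] := (closure_sqn A x).1 Ax e e0; exists y => //; rewrite rdotC vA.
Qed.

Lemma real_orth_sum_closure Z A : closed_real_subspace Z -> A `<=` Z -> A 0 ->
  (forall a x y, A x -> A y -> A (a%:C *: x + y)) ->
  real_orth_sum ip Z (real_orth_compl ip A `&` Z) (closure A).
Proof.
move=> hZ AZ A0 lA; have hA := closed_real_subspace_closure A0 lA.
have cAZ : closure A `<=` Z.
  by rewrite [Z in _ `<=` Z]((closure_id Z).1 (subspace_closed hZ)); exact: closureS.
split=> [v cAv x [Ax _]|].
  by rewrite rdotC; move: Ax; rewrite -orth_closure; apply.
apply/seteqP; split=> [z Zz|_ [x [y [[_ Zx] cAy ->]]]]; last first.
  by apply: subspaceD => //; apply: cAZ.
have [Ap zp] := real_projP z hA.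
exists (z - real_proj ip (closure A) z), (real_proj ip (closure A) z).
rewrite subrK -orth_closure; split=> //; split=> //.
by apply: subspaceB => //; apply: cAZ.
Qed.

(** The two conditions say that v is orthogonal to X, hence to X + i X, for the
    complex inner product. *)
Lemma cyclic_orth_eq0 X v :
  dense (sumset X (imul X)) -> real_orth_compl ip X v ->
  symplectic_compl ip X v -> v = 0.
Proof.
move=> dX vR vI; apply: sqn_eq0; apply: rdot_eq0_approx => e e0.
have [_ [x [_ [Xx [y Xy <-] ->]]] vxy] := dense_sqn v dX e0.
exists (x + 'i *: y) => //.
by rewrite rdotC rdotDr rdot_ir vR// vI// oppr0 addr0.
Qed.

(** * The polarizer *)

Section Polarizer.
Variable X : set V.
Hypothesis hX : closed_real_subspace X.

(** Im <h, k> = (h, - i k), and projecting - i k to X does not change its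
    product with h in X. *)
Lemma is_polarizer_proj :
  is_polarizer ip X (fun k => real_proj ip X (- ('i *: k))).
Proof.
split=> [k Xk|a h k Xh Xk||h k Xh Xk].
- by case: (real_projP (- ('i *: k)) hX).
- have [Ph oh] := real_projP (- ('i *: h)) hX.
  have [Pk ok] := real_projP (- ('i *: k)) hX.
  apply: real_proj_unique => //; first by apply: subspaceD => //; apply: subspaceZ.
  move=> x Xx; move: (oh x Xx) (ok x Xx).
  rewrite scalerDr scalerA mulrC -scalerA !rdotE => /subr0_eq <- /subr0_eq <-.
  by rewrite mulrN; lra.
- exists 1 => k Xk; rewrite mul1r.
  have [Pk ok] := real_projP (- ('i *: k)) hX.
  apply: norm_le_sqn; rewrite -(sqn_i k) -(sqnN ('i *: k)).
  exact: real_proj_contraction.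
- have [Pk ok] := real_projP (- ('i *: k)) hX.
  have := ok h Xh; rewrite rdotC rdotDr !rdotNr rdot_ir; lra.
Qed.

Local Notation D := (polarizer ip X).

Lemma polarizerP : is_polarizer ip X D.
Proof. exact: xgetI is_polarizer_proj. Qed.

Lemma polarizer_in k : X k -> X (D k).
Proof. by case: polarizerP => + _ _ _; apply. Qed.

Lemma polarizer_linear a h k : X h -> X k ->
  D (a%:C *: h + k) = a%:C *: D h + D k.
Proof. by case: polarizerP => _ + _ _; apply. Qed.

Lemma rdot_polarizer h k : X h -> X k ->
  rdot h (D k) = complex.Im (ip h k).
Proof. by case: polarizerP => _ _ _ + Xh Xk => ->. Qed.

Lemma polarizer_unique k d : X k -> X d ->
  (forall h, X h -> complex.Im (ip h k) = rdot h d) -> D k = d.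
Proof.
move=> Xk Xd kd; apply/eqP; rewrite -subr_eq0; apply/eqP.
apply: (@real_orth_self_eq0 X); first by apply: subspaceB => //; apply: polarizer_in.
by move=> x Xx; rewrite rdotC rdotDr rdotNr rdot_polarizer// kd// subrr.
Qed.

Lemma polarizer0 : D 0 = 0.
Proof.
by apply: polarizer_unique => [||h _]; rewrite ?ip0r//; exact: subspace0.
Qed.

(** Im <y, h> = (y, D h) is read here with the polarizer on h, and in
    symplectic_orth_image with the polarizer on y: D is antisymmetric. *)
Lemma symplectic_polarizer Y h : X h -> Y `<=` X ->
  symplectic_compl ip Y h <-> real_orth_compl ip Y (D h).
Proof.
move=> Xh YX; split=> hY y Yy.
  by rewrite rdotC rdot_polarizer ?hY//; [rewrite ImC hY ?oppr0|apply: YX].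
by rewrite ImC -rdot_polarizer//; [rewrite rdotC hY ?oppr0|exact: YX].
Qed.

Lemma symplectic_orth_image Y h : X h -> Y `<=` X ->
  symplectic_compl ip Y h <-> real_orth_compl ip (D @` Y) h.
Proof.
move=> Xh YX; split=> [hY _ [y Yy <-]|hY y Yy].
  by rewrite rdot_polarizer ?hY//; exact: YX.
by rewrite -rdot_polarizer//; [apply: hY; exists y|exact: YX].
Qed.

(** The real orthogonal complement of X is i X', so D k = d says that d is in
    - i k + i X'. *)
Lemma polarizer_eqP k d : X k -> X d ->
  D k = d <-> real_orth_compl ip X (d + 'i *: k).
Proof.
move=> Xk Xd; split=> [<- h Xh|dk].
  by rewrite rdotDl rdot_il rdotC rdot_polarizer// ImC addNr.
apply: polarizer_unique => // h Xh.
have := dk h Xh; rewrite rdotDl rdot_il rdotC ImC; lra.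
Qed.

End Polarizer.

(** * The modular operator at the eigenvalue 1 *)

Lemma self_adjoint_linear (T : set (V * V)) (c : R[i]) x1 y1 x2 y2 :
  self_adjoint ip T -> T (x1, y1) -> T (x2, y2) ->
  T (c *: x1 + x2, c *: y1 + y2).
Proof.
move=> [_ ->] T1 T2 x y Txy /=.
by rewrite !ipDl !ipZl (T1 x y Txy) (T2 x y Txy).
Qed.

Lemma self_adjoint_sym (T : set (V * V)) x1 y1 x2 y2 :
  self_adjoint ip T -> T (x1, y1) -> T (x2, y2) -> ip x1 y2 = ip y1 x2.
Proof. by move=> [_ {1}->] T1 /T1. Qed.

(** Polarization: the real parts agree, and replacing y by i y turns the real
    part into the imaginary part with the sign of antilinearity. *)
Lemma antilinear_isometry_ip (J : V -> V) x y :
  antilinear J -> (forall z, `|J z| = `|z|) -> ip (J x) (J y) = (ip x y)^*.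
Proof.
move=> lJ isoJ.
have isoS z : sqn (J z) = sqn z by apply: complexI; rewrite !sqn_norm isoJ.
have rJ u w : rdot (J u) (J w) = rdot u w.
  have JD : J (u + w) = J u + J w.
    by have := lJ 1 u w; rewrite rmorph1 !scale1r.
  have := isoS (u + w); rewrite JD !rdotE !isoS (rdotC w u) (rdotC (J w)); lra.
have J0 : J 0 = 0.
  by apply: sqn_eq0; rewrite isoS rdot0r.
have JZ : J ('i *: y) = - ('i *: J y).
  have := lJ Num.imaginary y 0; rewrite !addr0 J0 addr0 => ->.
  by rewrite conjCi scaleNr.
have := rJ x ('i *: y); rewrite JZ rdotNr !rdot_ir opprK => iJ.
apply/eqP; rewrite eq_complex rJ iJ.
by case: (ip x y) => a b /=; rewrite !eqxx.
Qed.

Section Modular.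
Variables (H : set V) (Delta : set (V * V)).
Hypothesis hH : standard H.

Local Notation H' := (symplectic_compl ip H).

Lemma tomita_in h : H h -> tomita H (h, h).
Proof.
have H0 : H 0 by case: hH => /subspace0.
by exists h, 0; rewrite scaler0 addr0 subr0.
Qed.

Lemma ker_tomita : op_ker (tomita H) = [set 0].
Proof.
have [hX _ sepH] := hH; have H0 := subspace0 hX.
apply/seteqP; split=> [x [h1 [h2 [H1 H2 /= -> /esym/subr0_eq e]]]|_ ->] /=.
  have : (H `&` imul H) h1 by split=> //; exists h2.
  by rewrite sepH -e /= => ->; rewrite addr0.
by exists 0, 0; rewrite scaler0 addr0 subr0.
Qed.

(** J is isometric on the orthogonal complement of its kernel, and the Tomita
    operator is injective. *)
Lemma polar_isometry J T : polar_decomposition ip (tomita H) J T ->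
  forall x, `|J x| = `|x|.
Proof.
move=> [_ _ iJ kJ _] x; apply: iJ; rewrite kJ ker_tomita => _ ->.
exact: ip0r.
Qed.

(** On a fixed point x of T the Tomita operator S agrees with J, and for k in H
    one gets <S x, k> = <J x, J T k> = <T x, k>^* = <x, k>^*. With
    x = h1 + i h2 and S x = h1 - i h2, the real and imaginary parts of this
    identity say that Im <h2, k> and Im <h1, k> vanish. *)
Lemma modular_fixed J T x : polar_decomposition ip (tomita H) J T ->
  T (x, x) -> exists h1 h2, [/\ (H `&` H') h1, (H `&` H') h2 & x = h1 + 'i *: h2].
Proof.
move=> pd Tx; have isoJ := polar_isometry pd.
have [[sT _] lJ _ _ ST] := pd.
have : tomita H (x, J x) by rewrite ST; exists x.
move=> [h1 [h2 [Hh1 Hh2 /= xE JxE]]].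
have key k : H k -> ip (h1 - 'i *: h2) k = (ip (h1 + 'i *: h2) k)^*.
  move=> /tomita_in; rewrite ST => -[t /= Tkt kt].
  rewrite -JxE -xE {1}kt antilinear_isometry_ip//.
  by rewrite (self_adjoint_sym sT Tx Tkt).
suff [I1 I2] : H' h1 /\ H' h2 by exists h1, h2.
have RI k : H k -> complex.Im (ip h1 k) = 0 /\ complex.Im (ip h2 k) = 0.
  move=> /key; rewrite !ipDl -scaleNr !ipZl -[Num.imaginary]/(Complex 0 1).
  case: (ip h1 k) (ip h2 k) => [a b] [c d] /=.
  by move=> -[]; lra.
by split=> k /RI[].
Qed.

(** As S h = h, the vector t = T h satisfies J t = h. For h in N and y in dom T,
    <h, S y> is the conjugate of <h, y>; since S y = J T y and J is
    antiunitary, this reads <t, T y> = <h, y>, so t is in the domain of the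
    adjoint of T, which is T, and T t = h. *)
Lemma fixed_modular J T h : polar_decomposition ip (tomita H) J T ->
  (H `&` H') h -> op_comp T T (h, h).
Proof.
move=> pd [Hh H'h]; have isoJ := polar_isometry pd.
have [[sT _] lJ _ _ ST] := pd.
have := tomita_in Hh; rewrite {1}ST => -[t /= Tht hJt].
exists t => //=; rewrite [T]sT.2 => y s Tys /=.
have : tomita H (y, J s) by rewrite ST; exists s.
move=> [k1 [k2 [Hk1 Hk2 /= yE JsE]]].
have : (ip h y)^* = ip h (J s).
  rewrite JsE yE -scaleNr !ipDr !ipZr -[Num.imaginary]/(Complex 0 1).
  move: (H'h k1 Hk1) (H'h k2 Hk2).
  case: (ip h k1) (ip h k2) => [a b] [c d] /= -> ->.
  by apply/eqP; rewrite eq_complex /=; apply/andP; split; apply/eqP; ring.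
by rewrite {2}hJt antilinear_isometry_ip// => /(can_inj (@conjcK R)) <-.
Qed.

(** If T x = y and T y = x then T (y - x) = - (y - x), and T has no negative
    eigenvalue, so y = x. *)
Lemma positive_sqrt_fixed (T : set (V * V)) x :
  self_adjoint ip T -> positive_op ip T -> op_comp T T (x, x) -> T (x, x).
Proof.
move=> sT pT [y /= Txy Tyx].
have : T (y - x, x - y).
  by have := self_adjoint_linear (-1) sT Txy Tyx; rewrite !scaleN1r !(addrC (- _)).
move=> /pT; rewrite -(opprB y x) ipNr oppr_ge0.
rewrite lecE => /andP[_ /= le0].
have /sqn_eq0/subr0_eq yx : sqn (y - x) = 0.
  by apply/eqP; rewrite eq_le le0 sqn_ge0.
by rewrite -{2}yx.
Qed.

Lemma eigenspace_modular : modular_operator ip H Delta ->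
  eigenspace_op Delta 1 = sumset (H `&` H') (imul (H `&` H')).
Proof.
move=> [J [T [pd ->]]]; have [[sT pT] _ _ _ _] := pd.
apply/seteqP; split=> x; rewrite /eigenspace_op /= ?scale1r.
  move=> /(positive_sqrt_fixed sT pT)/(modular_fixed pd)[h1 [h2 [h1N h2N ->]]].
  by exists h1, ('i *: h2); split=> //; exists h2.
move=> [h1 [_ [h1N [h2 h2N <-] ->]]].
have [t1 /= T1 T1'] := fixed_modular pd h1N.
have [t2 /= T2 T2'] := fixed_modular pd h2N.
rewrite (addrC h1); exists ('i *: t2 + t1) => /=.
  exact: (self_adjoint_linear _ sT T2 T1).
exact: (self_adjoint_linear _ sT T2' T1').
Qed.

Local Notation N := (H `&` H').

Lemma closed_center : closed_real_subspace N.
Proof.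
case: hH => hX _ _.
by apply: closed_real_subspaceI => //; exact: closed_real_subspace_symplectic.
Qed.

(** For r in H and n in H' the product <r, n> is real, so real orthogonality to N
    is complex orthogonality. *)
Lemma orth_compl_center r : H r -> real_orth_compl ip N r ->
  orth_compl ip (sumset N (imul N)) r.
Proof.
move=> Hr rN.
have oN n : N n -> ip r n = 0.
  by move=> Nn; apply: ip_eq0; rewrite ?rN// ImC Nn.2 ?oppr0.
by move=> _ [n [_ [Nn [m Nm <-] ->]]]; rewrite ipDr ipZr !oN// mulr0 addr0.
Qed.

(** For h in H the real projection p of h to N has h - p in H, so h - p is
    orthogonal to N + i N and p is the complex projection too. *)
Lemma eigen_proj_modular h : modular_operator ip H Delta -> H h ->
  eigen_proj ip Delta 1 h = real_proj ip N h.
Proof.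
move=> mD Hh; rewrite /eigen_proj eigenspace_modular//.
have [Np op] := real_projP h closed_center; set p := real_proj _ _ _ in Np op *.
have hX : closed_real_subspace H by case: hH.
have Hp : H (h - p) by apply: subspaceB => //; case: Np.
have oE := orth_compl_center Hp op.
have N0 := subspace0 closed_center.
apply: xget_unique => /=.
  split=> //; exists p, 0; rewrite addr0; split=> //.
  by exists 0 => //; rewrite scaler0.
move=> q [[n [_ [Nn [m Nm <-] qE]]] hq].
apply/subr0_eq/sqn_eq0; have -> : sqn (q - p) = complex.Re (ip ((h - p) - (h - q)) (q - p)).
  by rewrite opprB [in RHS]addrC subrKA.
have EB : sumset N (imul N) (q - p).
  exists (n - p), ('i *: m); split; [|by exists m|by rewrite qE addrAC].
  exact: (subspaceB closed_center).
by rewrite ipDl ipNl (oE _ EB) (hq _ EB) oppr0 addr0.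
Qed.

Lemma eigen_proj_compl : modular_operator ip H Delta ->
  [set h - eigen_proj ip Delta 1 h | h in H] = real_orth_compl ip N `&` H.
Proof.
move=> mD; have hX : closed_real_subspace H by case: hH.
apply/seteqP; split=> [_ [h Hh <-]|r [rN Hr]].
  have [Np op] := real_projP h closed_center.
  by rewrite eigen_proj_modular//; split=> //; apply: subspaceB => //; case: Np.
exists r => //; rewrite eigen_proj_modular//.
by rewrite (real_proj_eq0 _ closed_center).2// subr0.
Qed.

End Modular.

(** * The complement of H `&` H' in H *)

Section CenterComplement.
Variable H : set V.
Hypothesis hH : standard H.

Local Notation N := (H `&` symplectic_compl ip H).
Local Notation Ht := (real_orth_compl ip N `&` H).

Let hX : closed_real_subspace H.
Proof. by case: hH. Qed.

Lemma closed_center_compl : closed_real_subspace Ht.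
Proof. exact: closed_real_subspaceI (closed_real_subspace_orth _) hX. Qed.

Lemma center_decomposition h : H h -> exists n z, [/\ N n, Ht z & h = n + z].
Proof.
move=> Hh; have [Nn on] := real_projP h (closed_center hH).
exists (real_proj ip N h), (h - real_proj ip N h); rewrite subrKC.
by split=> //; split=> //; apply: (subspaceB hX) => //; case: Nn.
Qed.

(** The equation Im <h, y> = (h, d), with y and d in the complement of N, has
    both sides zero for h in N, so that testing it on H amounts to testing it on
    the complement. *)
Lemma polarizer_center_compl y : Ht y -> polarizer ip H y = polarizer ip Ht y.
Proof.
move=> Hty; have [_ Hy] := Hty.
have Dy := polarizer_in closed_center_compl Hty.
apply: (polarizer_unique hX) => // [|h /center_decomposition[n [z [Nn Htz ->]]]].
  by case: Dy.
rewrite rdotDl (rdot_polarizer closed_center_compl Htz Hty) (rdotC n) Dy.1// add0r.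
by rewrite ipDl raddfD/= Nn.2// add0r.
Qed.

Lemma orth_sum_center : orth_sum ip H N Ht.
Proof.
split=> [y [yN Hy] n Nn|].
  by apply: ip_eq0; rewrite ?yN// ImC Nn.2 ?oppr0.
apply/seteqP; split=> [h /center_decomposition[n [z [Nn Hz ->]]]|].
  by exists n, z.
by move=> _ [n [z [[Hn _] [_ Hz] ->]]]; apply: (subspaceD hX).
Qed.

End CenterComplement.

End RealInnerProduct.

(** * The relative symplectic complement of an inclusion *)

Theorem lemma3p4 (R : realType) (V : completeNormedModType R[i])
    (ip : V -> V -> R[i]) (hip : inner_product ip) (hsep : separable V)
    (H K : set V) (hH : standard H) (hK : standard K) (hKH : K `<=` H)
    (Delta : set (V * V)) (hDelta : modular_operator ip H Delta) :
  let D := polarizer ip H in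
  let H' := symplectic_compl ip H in
  let K' := symplectic_compl ip K in
  let Q := eigen_proj ip Delta 1 in
  let Ht := [set h - Q h | h in H] in
  let Dtinv := polarizer_inv ip Ht in
  (* (a) *)
  (real_orth_sum ip H (K' `&` H) (closure (D @` K)) /\
   K' `&` H = [set h | H h /\ real_proj ip K (D h) = 0]) /\
  (* (b) *)
  (orth_sum ip H (H `&` H') Ht /\
   orth_sum ip (K' `&` H) (H' `&` H)
     (op_image Dtinv (real_orth_compl ip K `&` Ht `&` op_dom Dtinv))) /\
  (* (c) *)
  (cyclic_subspace (K' `&` H) ->
   symplectic_compl ip (K' `&` H) `&` closure (D @` K) = [set 0]) /\
  (* (d) *)
  (K `&` (D @` K) `&` op_dom Delta `<=` K `&` sumset (imul K) (imul H') /\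
   K `&` sumset (imul K) (imul H') `<=` K `&` (D @` K)).
Proof.
move=> D H' K' Q Ht Dtinv.
have [[hX _ _] [hY _ _]] := (hH, hK).
have K'E : K' `&` H = real_orth_compl ip (D @` K) `&` H.
  by apply/seteqP; split=> h [+ Hh]; move=> /(symplectic_orth_image hip hX Hh hKH).
have sum_a : real_orth_sum ip H (K' `&` H) (closure (D @` K)).
  rewrite K'E; apply: real_orth_sum_closure => //.
  - by move=> _ [k Kk <-]; apply: polarizer_in => //; apply: hKH.
  - by exists 0; [exact: subspace0|exact: polarizer0].
  - move=> a _ _ [k Kk <-] [l Kl <-]; exists (a%:C *: k + l).
      by apply: subspaceD => //; apply: subspaceZ.
    by apply: polarizer_linear => //; apply: hKH.
split; [split=> //|split; [|split]].
- apply/seteqP; split=> h [].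
    move=> K'h Hh; split=> //; apply/(real_proj_eq0 hip _ hY).
    exact/(symplectic_polarizer hip hX Hh hKH).
  move=> Hh /(real_proj_eq0 hip _ hY) Dh; split=> //.
  exact/(symplectic_polarizer hip hX Hh hKH).
- have HtE : Ht = real_orth_compl ip (H `&` H') `&` H by exact: eigen_proj_compl.
  have [oHt _] := orth_sum_center hip hH.
  have hDt y : Ht y -> K' y <-> real_orth_compl ip K (polarizer ip Ht y).
    rewrite HtE => Hty; rewrite -polarizer_center_compl//.
    by apply: symplectic_polarizer => //; case: Hty.
  have WE : op_image Dtinv (real_orth_compl ip K `&` Ht `&` op_dom Dtinv) =
      K' `&` Ht.
    apply/seteqP; split=> [y [x [[Kx _] _] [Hty xE]]|y [K'y Hty]].
      by split=> //; apply/hDt => //; rewrite -xE.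
    exists (polarizer ip Ht y) => //; split; last by exists y.
    split; first exact/hDt.
    by move: Hty; rewrite HtE; apply: polarizer_in => //; exact: closed_center_compl.
  rewrite WE HtE; split; first exact: orth_sum_center.
  split.
    by move=> y [_ /oHt oy] n [H'n Hn]; exact: oy.
  have hK' : closed_real_subspace K' by exact: closed_real_subspace_symplectic.
  have H'K' : H' `<=` K' by move=> v H'v k /hKH; exact: H'v.
  apply/seteqP; split=> [h [K'h Hh]|_ [n [z [[H'n Hn] [K'z [_ Hz]] ->]]]].
    have [n [z [[Hn H'n] Hz hE]]] := center_decomposition hip hH Hh.
    exists n, z; split=> //; split=> //.
    have -> : z = h - n by rewrite hE (addrC n) addrK.
    by apply: (subspaceB hK') => //; exact: H'K'.
  by split; [apply: (subspaceD hK') => //; exact: H'K'|exact: (subspaceD hX)].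
- move=> cK; apply/seteqP; split=> [v [vI vR]|_ ->].
    by apply: (cyclic_orth_eq0 hip cK) => //; apply: sum_a.1.
  split; first exact: (subspace0 (closed_real_subspace_symplectic hip _)).
  by apply: subset_closure; exists 0; [exact: subspace0|exact: polarizer0].
- split=> [d [[Kd [k Kk kd]] _]|d [Kd [_ [_ [[k Kk <-] [m H'm <-] dE]]]]]; split=> //.
    have odk := (polarizer_eqP hip hX (hKH k Kk) (hKH d Kd)).1 kd.
    exists ('i *: (- k)), (d + 'i *: k); split; first by exists (- k) => //; apply: subspaceN.
      exists (- ('i *: (d + 'i *: k))); last by rewrite scalerN mulii opprK.
      by move=> h Hh; rewrite -scalerN Im_il// rdotNl// odk// !oppr0.
    by rewrite scalerN [RHS]addrC addrK.
  exists (- k); first exact: subspaceN.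
  apply/(polarizer_eqP hip hX (hKH _ (subspaceN hY Kk)) (hKH d Kd)).
  move=> h Hh; rewrite dE scalerN addrAC subrr add0r rdot_il//; exact: H'm.
Qed.
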